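(* The ideal $\mathcal{WR}$ is locally selective and is not weakly Ramsey.
   Context: An ideal on a countable set $X$ is a collection $\mathcal{I}\subset\mathcal{P}(X)$ closed under subsets and finite unions, with $\mathcal{I}\neq\mathcal{P}(X)$ and containing all finite subsets of $X$. $\mathcal{I}^*=\{A\subset X: X\setminus A\in\mathcal{I}\}$ is the dual filter; a set $A\subset X$ is $\mathcal{I}$-positive if $A\notin\mathcal{I}$. A family $\mathcal{G}$ generates $\mathcal{I}$ if $\mathcal{I}$ consists of all sets covered by finitely many members of $\mathcal{G}$. $\mathcal{WR}$ is the ideal on $\omega\times\omega$ generated by the vertical lines $\{n\}\times\omega$, $n\in\omega$, together with all sets $G\subset\omega\times\omega$ such that for every two distinct points $(i,j),(k,l)\in G$ either $i>k+l$ or $k>i+j$. A selector of a partition is a set containing exactly one point of each nonempty piece. An ideal $\mathcal{I}$ on $X$ is locally selective if every partition $(X_n)_{n\in\omega}\subset\mathcal{I}$ of $X$ has an $\mathcal{I}$-positive selector. A tree is a nonempty set $T\subset X^{<\omega}$ of finite sequences of elements of $X$ closed under initial segments. The ramification of $T$ at $s\in T$ is $\{x\in X: s^\frown(x)\in T\}$. A branch of $T$ is a function $b:\omega\to X$ with $(b(0),\ldots,b(k))\in T$ for all $k\in\omega$; it is $\mathcal{I}$-positive if its range $b[\omega]$ is $\mathcal{I}$-positive. $\mathcal{I}$ is weakly Ramsey if every tree $T\subset X^{<\omega}$ with all ramifications in $\mathcal{I}^*$ has an $\mathcal{I}$-positive branch. *)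

(* Defs.v *)
From mathcomp Require Import all_boot.
From mathcomp Require Import boolp classical_sets functions cardinality.

Set Implicit Arguments.
Unset Strict Implicit.
Unset Printing Implicit Defensive.

Local Open Scope classical_set_scope.

Record ideal (X : countType) := Ideal {
  ideal_sets :> set X -> Prop;
  ideal_sub : forall A B : set X, A `<=` B -> ideal_sets B -> ideal_sets A;
  ideal_setU : forall A B : set X,
    ideal_sets A -> ideal_sets B -> ideal_sets (A `|` B);
  ideal_proper : ~ ideal_sets setT;
  ideal_finite : forall A : set X, finite_set A -> ideal_sets A
}.

Definition dual_filter (X : countType) (I : ideal X) : set (set X) :=
  [set A | I (~` A)].

Definition positive (X : countType) (I : ideal X) (A : set X) : Prop := ~ I A.

Definition generated (X : Type) (G : set (set X)) : set (set X) :=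
  [set A | exists2 F : set (set X),
     finite_set F /\ F `<=` G & A `<=` \bigcup_(B in F) B].

(* Unlike the library's [partition], pieces are allowed to be empty. *)
Definition is_partition (X : Type) (P : nat -> set X) : Prop :=
  cover setT P = setT /\ trivIset setT P.

Definition selector (X : Type) (P : nat -> set X) (S : set X) : Prop :=
  forall n, P n !=set0 -> exists x, S `&` P n = [set x].

Definition locally_selective (X : countType) (I : ideal X) : Prop :=
  forall P : nat -> set X,
    is_partition P -> (forall n, I (P n)) ->
    exists2 S : set X, selector P S & positive I S.

Definition is_tree (X : countType) (T : set (seq X)) : Prop :=
  T !=set0 /\ forall s t : seq X, prefix s t -> T t -> T s.

Definition ramification (X : Type) (T : set (seq X)) (s : seq X) : set X :=
  [set x | T (rcons s x)].

Definition branch (X : Type) (T : set (seq X)) (b : nat -> X) : Prop :=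
  forall k, T (mkseq b k.+1).

Definition weakly_Ramsey (X : countType) (I : ideal X) : Prop :=
  forall T : set (seq X),
    is_tree T -> (forall s, T s -> dual_filter I (ramification T s)) ->
    exists2 b : nat -> X, branch T b & positive I (range b).

Definition vertical_line (n : nat) : set (nat * nat) := [set n] `*` setT.

Definition WR_sparse (G : set (nat * nat)) : Prop :=
  forall i j k l : nat, G (i, j) -> G (k, l) -> (i, j) <> (k, l) ->
    (k + l < i)%N \/ (i + j < k)%N.

Definition WR_sets : set (set (nat * nat)) :=
  generated (range vertical_line `|` WR_sparse).

Lemma generated_sub (X : Type) (G : set (set X)) (A B : set X) :
  A `<=` B -> generated G B -> generated G A.
Proof. by move=> AB [F FG BF]; exists F => //; exact: subset_trans BF. Qed.

Lemma generated_setU (X : Type) (G : set (set X)) (A B : set X) :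
  generated G A -> generated G B -> generated G (A `|` B).
Proof.
move=> [F [finF FG] AF] [H [finH HG] BH]; exists (F `|` H).
  by split; [rewrite finite_setU | rewrite subUset].
by rewrite bigcup_setU; apply: setUSS.
Qed.

Lemma WR_finite (A : set (nat * nat)) : finite_set A -> WR_sets A.
Proof.
move=> finA; exists ((fun p => vertical_line p.1) @` A).
  split; first exact: finite_image.
  by move=> _ [p _ <-]; left; exists p.1.
by move=> p Ap; exists (vertical_line p.1) => //; exists p.
Qed.

Lemma WR_proper : ~ WR_sets setT.
Proof.
move=> [F [finF FG] covF].
have [n nF] : exists n, ~ F (vertical_line n).
  apply: contrapT => /forallNP allF; apply: infinite_nat.
  suff -> : [set: nat] = vertical_line @^-1` F.
    apply: finite_preimage finF => m n _ _ /seteqP [mn _].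
    by have [] := mn (m, 0) (conj erefl I).
  by apply/seteqP; split => // m _; exact: contrapT (allF m).
have /choice [B HB] : forall j, exists B, F B /\ B (n, j).
  by move=> j; have [B FB Bj] := covF (n, j) I; exists B.
apply: infinite_nat.
suff -> : [set: nat] = B @^-1` F.
  apply: finite_preimage finF => j l _ _ Bjl; apply: contrapT => jl.
  have [FB Bj] := HB j; have [_ Bl] := HB l; rewrite -Bjl in Bl.
  case: (FG _ FB) => [[m _ Bm]|sp].
    move: Bj; rewrite -Bm => -[/= nm _].
    by apply: nF; rewrite nm Bm.
  have njl : (n, j) <> (n, l) by move=> [].
  by case: (sp _ _ _ _ Bj Bl njl); rewrite ltnNge leq_addr.
by apply/seteqP; split => // j _; exact: (HB j).1.
Qed.

Definition WR : ideal (nat * nat)%type :=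
  Ideal (@generated_sub _ _) (@generated_setU _ _) WR_proper WR_finite.

(* Main.v *)
Require Import Defs.
From mathcomp Require Import all_boot.
From mathcomp Require Import boolp classical_sets functions cardinality.

(** Call two points [(i, j)], [(k, l)] overlapping when [i <= k + l] and
    [k <= i + j], that is when a sparse set cannot contain both unless they are
    equal.  Two points of one vertical line overlap, and so do any two points
    whose second coordinates dominate both first coordinates.

    Failure of the weak Ramsey property: take the tree of the sequences in
    which the first coordinate of each point exceeds the coordinate sum of every
    earlier point.  Each node excludes only the points of finitely many vertical
    lines, whereas the range of any branch is sparse by construction.

    Local selectivity: a set in the ideal is covered by finitely many lines and,
    say, [m] sparse sets, so beyond finitely many lines it cannot contain more
    than [m] pairwise overlapping points ([WR_overlap_bound]).  It is therefore
    enough to find a selector which, for every [N], contains [N + 1] pairwise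
    overlapping points with first coordinates at least [N].  For fixed [N] there
    is an infinite supply of pieces from which such points can be drawn
    ([overlapping_transversals]).  There are two cases.
    - Some line beyond [N] meets every piece in a finite set.  Then it meets
      infinitely many pieces, and points on that one line overlap.
    - Every line beyond [N] meets some piece in an infinite set.  A piece is in
      the ideal, so it does so for only finitely many lines; hence infinitely
      many pieces occur.  Fix pieces and corresponding lines, then pick on each
      line a point higher than the index of all the chosen lines.
    The demands for all [N] together compete for pieces, but each is met by an
    infinite set of pieces, so they can be served by pairwise distinct pieces
    ([distinct_representatives]).  The remaining pieces contribute arbitrary
    points. *)

Set Implicit Arguments.
Unset Strict Implicit.
Unset Printing Implicit Defensive.

Local Open Scope classical_set_scope.

(** * Infinite sets and distinct representatives *)

Lemma finite_set_nat_bounded (A : set nat) :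
  finite_set A -> exists M, forall i, A i -> i < M.
Proof.
move=> /finite_seqP[s ->]; exists (\max_(i <- s) i).+1 => i /= si.
by rewrite ltnS; exact: leq_bigmax_seq.
Qed.

Lemma infinite_set_notin (T : eqType) (A : set T) (s : seq T) :
  infinite_set A -> exists2 x, A x & x \notin s.
Proof.
move=> infA; apply: contrapT => nox; apply: infA.
apply: (sub_finite_set _ (finite_seq s)) => x Ax /=.
by apply/negPn/negP => xs; apply: nox; exists x.
Qed.

(** Countably many infinite sets can be served greedily: along the enumeration
    of [I], the representative of [i] avoids the finitely many points already
    given away. *)
Lemma distinct_representatives (I : countType) (T : eqType) (R : I -> set T) :
  (forall i, infinite_set (R i)) ->
  exists2 h : I -> T, injective h & forall i, R i (h i).
Proof.
move=> infR.
have /choice[g gP] : forall a : I * seq T, exists x, R a.1 x /\ x \notin a.2.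
  by move=> [i s]; have [x] := infinite_set_notin s (infR i); exists x.
(* [L n] lists the points given to the indices of code less than [n]. *)
pose L := fix L n := if n is m.+1 then
  (if unpickle m is Some i then g (i, L m) :: L m else L m) else [::].
pose h i := g (i, L (pickle i)).
have LS m n : m <= n -> {subset L m <= L n}.
  elim: n => [|n IHn]; first by rewrite leqn0 => /eqP->.
  rewrite leq_eqVlt => /orP[/eqP-> // | /IHn mn] x /mn xn /=.
  by case: unpickle => [i|] //; rewrite inE xn orbT.
have hL i j : pickle i < pickle j -> h i != h j.
  move=> /LS sub; have [_] := gP (j, L (pickle j)); apply: contraNneq => eqh.
  by rewrite -[g _]/(h j) -eqh; apply: sub; rewrite /= pickleK mem_head.
exists h => [i j eqh | i]; last by have [] := gP (i, L (pickle i)).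
apply: (pcan_inj pickleK); case: (ltngtP (pickle i) (pickle j)) => // /hL.
  by rewrite eqh eqxx.
by rewrite eqh eqxx.
Qed.

(** * Overlapping points and the sets of the ideal *)

Lemma finite_vertical_lines (F : set (set (nat * nat))) :
  finite_set F -> finite_set (vertical_line @^-1` F).
Proof.
apply: finite_preimage => m n _ _ /seteqP[mn _].
by have [] := mn (m, 0) (conj erefl I).
Qed.

Lemma infinite_column_unbounded (A : set (nat * nat)) i J :
  infinite_set (A `&` vertical_line i) ->
  exists x, [/\ A x, x.1 = i & J <= x.2].
Proof.
move=> infA; apply: contrapT => nox; apply: infA.
apply: (@sub_finite_set _ _ ([set i] `*` `I_J)); last exact: finite_setX.
move=> x [Ax [/= xi _]]; split=> //=; rewrite ltnNge; apply/negP => Jx.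
by apply: nox; exists x.
Qed.

Definition overlap (x y : nat * nat) : Prop :=
  x.1 <= y.1 + y.2 /\ y.1 <= x.1 + x.2.

Lemma WR_sparse_overlap G x y :
  WR_sparse G -> G x -> G y -> overlap x y -> x = y.
Proof.
case: x y => [i j] [k l] spG Gx Gy [/= ikl kij]; apply: contrapT => xy.
by case: (spG _ _ _ _ Gx Gy xy); rewrite ltnNge ?ikl ?kij.
Qed.

(** The bound [N] is the larger of the number of sets in a finite cover of [A]
    by generators and a strict bound on the indices of the lines among them.
    Points beyond those lines lie in sparse sets of the cover, and distinct
    overlapping points lie in different ones, so [N + 1] of them are too many. *)
Lemma WR_overlap_bound A : WR A -> exists N, forall p : nat -> nat * nat,
  (forall t, A (p t) /\ N <= (p t).1) ->
  (forall s t, s <= N -> t <= N -> overlap (p s) (p t)) ->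
  ~ injective p.
Proof.
move=> [F [finF FG] AF].
have [M linesM] : exists M, forall i, F (vertical_line i) -> i < M.
  exact: finite_set_nat_bounded (finite_vertical_lines finF).
move: (finF) => /finite_seqP[s Fs].
exists (maxn M (size s)) => p pA pN p_inj.
have /choice[B BP] : forall t, exists B, F B /\ B (p t).
  by move=> t; have [B FB Bt] := AF _ (pA t).1; exists B.
have spB t : WR_sparse (B t).
  have [FB Bt] := BP t; case: (FG _ FB) => // -[m _ mB].
  move: FB Bt; rewrite -mB => /linesM mM -[/= ptm _].
  by have [_] := pA t; rewrite ptm geq_max leqNgt mM.
pose r := [seq B t | t <- iota 0 (maxn M (size s)).+1].
have : size r <= size s.
  apply: uniq_leq_size => [|_ /mapP[t _ ->]]; last by have [] := BP t; rewrite Fs.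
  rewrite map_inj_in_uniq ?iota_uniq // => t u.
  rewrite !mem_iota !add0n !ltnS => /= tN uN eqB; apply: p_inj.
  apply: WR_sparse_overlap (spB t) (BP t).2 _ (pN _ _ tN uN).
  by rewrite eqB; exact: (BP u).2.
by rewrite size_map size_iota ltnNge leq_maxr.
Qed.

(** A sparse set has at most one point on each line, so the only lines that [A]
    meets in an infinite set are among those used to cover it. *)
Lemma WR_infinite_columns_finite A :
  WR A ->
  finite_set [set i | infinite_set (A `&` vertical_line i)].
Proof.
move=> [F [finF FG] AF].
apply: sub_finite_set (finite_vertical_lines finF) => i /= infAi.
apply: contrapT => nFi; apply: infAi.
apply: (@sub_finite_set _ _ (\bigcup_(B in F) (B `&` vertical_line i))).
  by move=> x [/AF[B FB Bx] ix]; exists B.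
apply: bigcup_finite => // B FB.
have [->|/eqP/set0P[x [Bx xi]]] := pselect (B `&` vertical_line i = set0).
  exact: finite_set0.
apply: (sub_finite_set _ (finite_set1 x)) => y [By yi] /=.
case: (FG _ FB) => [[m _ mB]|spB].
  case: nFi; suff -> : i = m by rewrite mB.
  by move: Bx xi; rewrite -mB => -[/= <- _] [/= <- _].
apply: (WR_sparse_overlap spB) => //.
by case: xi yi => /= xi _ [/= yi _]; rewrite /overlap xi yi !leq_addr.
Qed.

(** * Local selectivity *)

(** The supply [R] is fixed first, and the points are found after the pieces
    [q t] have been allotted from it, which leaves the freedom to serve all [N]
    at once by distinct pieces. *)
Lemma overlapping_transversals (P : nat -> set (nat * nat)) N :
  cover setT P = setT -> (forall n, WR (P n)) ->
  exists R : set nat, infinite_set R /\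
    forall q : nat -> nat, (forall t, R (q t)) ->
    exists p : nat -> nat * nat,
      (forall t, P (q t) (p t) /\ N <= (p t).1) /\
      (forall s t, s <= N -> t <= N -> overlap (p s) (p t)).
Proof.
move=> covP WRP.
have [[i [Ni finPi]]|noline] := pselect (exists i, N <= i /\
    forall n, finite_set (P n `&` vertical_line i)).
  (* [i] is a line with finite traces: the pieces meeting it are the supply. *)
  exists [set n | P n `&` vertical_line i !=set0]; split.
    move=> finR; apply: infinite_nat.
    have : finite_set (vertical_line i).
      apply: sub_finite_set (bigcup_finite finR (fun n _ => finPi n)) => x xi.
      have : cover setT P x by rewrite covP.
      by move=> [n _ Pnx]; exists n => //; exists x.
    move=> /(finite_image snd); apply: sub_finite_set => j _.
    by exists (i, j).
  move=> q Rq; have /choice[p pP] := Rq; exists p; split=> [t|s t _ _].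
    by have [Pt [/= -> _]] := pP t.
  have [_ [/= ps _]] := pP s; have [_ [/= pt _]] := pP t.
  by rewrite /overlap ps pt !leq_addr.
(* Every line from [N] on has an infinite trace of some piece. *)
exists [set n | exists2 i, N <= i & infinite_set (P n `&` vertical_line i)].
split.
  move=> finR; apply: noline.
  have finC := bigcup_finite finR (fun n _ => WR_infinite_columns_finite (WRP n)).
  have [M CM] := finite_set_nat_bounded finC.
  exists (maxn N M).
  rewrite leq_maxl; split=> // n; apply: contrapT => infn.
  have /CM : (\bigcup_(n in [set n | exists2 i, N <= i &
      infinite_set (P n `&` vertical_line i)])
      [set i | infinite_set (P n `&` vertical_line i)]) (maxn N M).
    by exists n => //; exists (maxn N M); rewrite ?leq_maxl.
  by rewrite ltnNge leq_maxr.
move=> q Rq.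
have /choice[c cP] : forall t, exists i, N <= i /\
    infinite_set (P (q t) `&` vertical_line i).
  by move=> t; have [i] := Rq t; exists i.
(* Only the first [N + 1] points have to overlap, so one height [J] above
   their lines suffices. *)
pose J := \max_(t < N.+1) c t.
have /choice[p pP] : forall t, exists x, [/\ P (q t) x, x.1 = c t & J <= x.2].
  by move=> t; exact: infinite_column_unbounded (cP t).2.
have pJ s t : s <= N -> (p s).1 <= (p t).2.
  move=> sN; have [_ -> _] := pP s; have [_ _] := pP t; apply: leq_trans.
  exact: (@leq_bigmax _ (fun u : 'I_N.+1 => c u) (Ordinal (sN : s < N.+1))).
exists p; split=> [t|s t sN tN].
  by have [Pt -> _] := pP t; split=> //; exact: (cP t).1.
by split; apply: leq_trans (leq_addl _ _); apply: pJ.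
Qed.

Lemma WR_locally_selective : locally_selective WR.
Proof.
move=> P [covP trivP] WRP.
have piece_eq m n x : P m x -> P n x -> m = n.
  by move=> Pm Pn; apply: trivP => //; exists x.
have /choice[R RP] := fun N => overlapping_transversals N covP WRP.
have [h h_inj hR] :=
  @distinct_representatives (nat * nat)%type nat (fun a => R a.1)
    (fun a => (RP a.1).1).
have /choice[p pP] : forall N, exists p : nat -> nat * nat,
    (forall t, P (h (N, t)) (p t) /\ N <= (p t).1) /\
    (forall s t, s <= N -> t <= N -> overlap (p s) (p t)).
  by move=> N; apply: (RP N).2 => t; exact: hR (N, t).
(* [c] chooses a point of each nonempty piece, the prescribed one if any. *)
have /choice[c cP] : forall n, exists x, P n !=set0 ->
    P n x /\ forall N t, h (N, t) = n -> x = p N t.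
  move=> n; have [[[N t] hn]|nh] := pselect (exists a, h a = n).
    exists (p N t) => _; split=> [|M u hMu]; first by rewrite -hn; exact: ((pP N).1 t).1.
    by have [-> ->] := h_inj _ _ (etrans hn (esym hMu)).
  have [[x Pnx]|nPn] := pselect (P n !=set0); last by exists (0, 0).
  by exists x => _; split=> // N t hn; case: nh; exists (N, t).
exists (c @` [set n | P n !=set0]) => [n Pn|WRS].
  exists (c n); apply/seteqP; split=> [x [[m Pm <-] Pnc] /=|_ ->].
    by rewrite (piece_eq _ _ _ Pnc (cP m Pm).1).
  by split; [exists n | exact: (cP n Pn).1].
have [N boundN] := WR_overlap_bound WRS.
have [PpN overlapN] := pP N.
apply: boundN (overlapN) _ => [t|s t pst].
  have [Pt Nt] := PpN t; split=> //.
  have ne : P (h (N, t)) !=set0 by exists (p N t).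
  by exists (h (N, t)) => //; exact: (cP _ ne).2.
have [Ps _] := PpN s; have [Pt _] := PpN t; rewrite pst in Ps.
by have [] := h_inj _ _ (piece_eq _ _ _ Ps Pt).
Qed.

(** * Failure of the weak Ramsey property *)

(** The tree consists of the sequences [s] with [fast s].  Its ramification at
    [s] contains all points whose first coordinate exceeds the coordinate sums
    in [s], and along a branch the inequality between any two points is one of
    the two alternatives that define sparseness. *)
Lemma WR_not_weakly_Ramsey : ~ weakly_Ramsey WR.
Proof.
pose fast (s : seq (nat * nat)) := pairwise (fun x y => x.1 + x.2 < y.1) s.
move=> /(_ [set s | fast s])[|s /= fast_s|b bT].
- split; first by exists [::].
  by move=> s _ /prefixP[u ->] /=; rewrite /fast pairwise_cat => /and3P[].
- exists (vertical_line @` `I_(\max_(x <- s) (x.1 + x.2)).+1).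
    by split; [apply/finite_image/finite_II | move=> _ [i _ <-]; left; exists i].
  move=> x nTx; exists (vertical_line x.1) => //; exists x.1 => //=.
  rewrite ltnS leqNgt; apply/negP => sx; apply: nTx.
  rewrite /ramification /= /fast pairwise_rcons -/(fast s) fast_s andbT; apply/allP => y ys.
  by apply: leq_ltn_trans sx; exact: (leq_bigmax_seq (F := fun x : nat * nat => x.1 + x.2)).
apply; exists [set range b]; last by move=> x bx; exists (range b).
split=> [|_ ->]; first exact: finite_set1.
have b_fast m n : m < n -> (b m).1 + (b m).2 < (b n).1.
  move=> mn; have /(pairwiseP (0, 0))/(_ m n) : fast (mkseq b n.+1) := bT n.
  by rewrite !inE size_mkseq !nth_mkseq ?ltnS ?(ltnW mn) //; apply.
right=> i j k l [m _ bm] [n _ bn] ne.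
case: (ltngtP m n) => [/b_fast|/b_fast|eqmn].
- by rewrite bm bn; right.
- by rewrite bm bn; left.
- by case: ne; rewrite -bm -bn eqmn.
Qed.

Theorem corollary4p5 : locally_selective WR /\ ~ weakly_Ramsey WR.
Proof. exact: conj WR_locally_selective WR_not_weakly_Ramsey. Qed.
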